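(* Let $G$ be a finite simple graph and let $X$ be an independent set of $G$ with $d(X)>0$ such that $d(Y)<d(X)$ for every proper subset $Y \subsetneq X$. Define the graph $H_X$ with vertex set $X \cup N(X) \cup \{v,w\}$, where $v,w$ are two new vertices not in $V(G)$, and edge set $\{xy \in E(G) : x\in X, y \in N(X)\} \cup \{vw\} \cup \{vx : x \in N(X)\}$. Then $\ker(H_X) = X$.
   Context: For a graph $H$ and $A \subseteq V(H)$, $N_H(A)$ is the set of vertices of $H$ adjacent to some vertex of $A$; $d_H(A)=|A|-|N_H(A)|$ (in $G$ written $N$, $d$). $d_c(H)=\max\{d_H(A): A\subseteq V(H)\}$; a set $A$ is critical if $d_H(A)=d_c(H)$, and $\ker(H)$ is the intersection of all critical sets of $H$. *)

(* Defs.v *)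
From mathcomp Require Import all_boot all_order all_algebra.
Set Implicit Arguments.
Unset Strict Implicit.
Unset Printing Implicit Defensive.
Import Order.TTheory GRing.Theory Num.Theory.

(* The vertex set is a subset of an ambient finite type U, so that a graph can
   be extended by new vertices taken from U, and vertex sets of different
   graphs over U can be compared directly. *)
Record sgraph (U : finType) := SGraph {
  vset : {set U};
  adj : rel U;
  adj_sym : symmetric adj;
  adj_irr : irreflexive adj;
  adj_vset : forall x y, adj x y -> x \in vset }.

Section Critical.
Variables (U : finType) (H : sgraph U).
Implicit Type A : {set U}.

Definition nbhd A : {set U} := [set y | [exists x in A, adj H x y]].

Definition independent A : Prop :=
  A \subset vset H /\ {in A &, forall x y, ~~ adj H x y}.

Definition diff A : int := (#|A|%:Z - #|nbhd A|%:Z)%R.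

(* The base value [diff set0] is itself a member of the family, hence this is
   the maximum over the subsets of the vertex set. *)
Definition crit_diff : int :=
  \big[Order.max/diff set0]_(A : {set U} | A \subset vset H) diff A.

Definition critical A : bool := (A \subset vset H) && (diff A == crit_diff).

Definition ker : {set U} := \bigcap_(A : {set U} | critical A) A.

Lemma nbhd_vset A x : x \in nbhd A -> x \in vset H.
Proof.
by rewrite inE => /existsP[y /andP[_ yx]]; apply: (@adj_vset _ H x y); rewrite adj_sym.
Qed.

End Critical.

Section HX.
Variables (U : finType) (G : sgraph U) (X : {set U}) (v w : U).
Hypotheses (vG : v \notin vset G) (vw : v != w).

Definition HX_vset : {set U} := X :|: nbhd G X :|: [set v; w].

Definition HX_arc : rel U := fun x y =>
  [|| [&& x \in X, y \in nbhd G X & adj G x y],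
      (x == v) && (y == w)
    | (x == v) && (y \in nbhd G X)].

Definition HX_adj : rel U := fun x y => HX_arc x y || HX_arc y x.

Lemma HX_adj_sym : symmetric HX_adj.
Proof. by move=> x y; rewrite /HX_adj orbC. Qed.

Lemma HX_adj_irr : irreflexive HX_adj.
Proof.
move=> x; rewrite /HX_adj orbb /HX_arc adj_irr !andbF /=.
case: eqVneq => //= ->; rewrite (negPf vw) /=.
by apply/negP => /nbhd_vset; apply/negP.
Qed.

Lemma HX_adj_vset x y : HX_adj x y -> x \in HX_vset.
Proof.
rewrite /HX_adj /HX_arc /HX_vset !in_setU !in_set1.
case/orP => /or3P[/and3P[]|/andP[]|/andP[]].
- by move=> ->.
- by move=> ->; rewrite !orbT.
- by move=> ->; rewrite !orbT.
- by move=> _ ->; rewrite !orbT.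
- by move=> _ ->; rewrite !orbT.
- by move=> _ ->; rewrite !orbT.
Qed.

Definition HX : sgraph U := SGraph HX_adj_sym HX_adj_irr HX_adj_vset.

End HX.

(* Main.v *)
(** For [A] in [H_X], put [Y = A :&: X] and [B = A :&: N(X)].  The neighbourhood
    of [A] in [H_X] contains the pairwise disjoint sets [N(Y)], [N(B) :&: X] and
    the image of [A :&: {v, w}] under the transposition of [v] and [w].
    Comparing [X] with [X :\: N(B)] gives the Hall inequality
    [|B| <= |N(B) :&: X|], so [A] has difference at most [d(Y)]; this is at most
    [d(X)], and smaller unless [Y = X].  Since [X] has the same neighbourhood in
    [H_X] as in [G], it is critical, and every critical set contains it. *)

Require Import Defs.
From mathcomp Require Import all_boot all_order all_algebra.
From mathcomp Require Import perm zify.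

Import Order.TTheory.

Lemma nbhdP {U : finType} {H : sgraph U} {A : {set U}} {y : U} :
  reflect (exists2 x, x \in A & adj H x y) (y \in nbhd H A).
Proof. by rewrite inE; apply: exists_inP. Qed.

Lemma nbhdS {U : finType} {H : sgraph U} {A B : {set U}} :
  A \subset B -> nbhd H A \subset nbhd H B.
Proof.
move=> /subsetP sAB; apply/subsetP => y /nbhdP[x /sAB xB xy].
by apply/nbhdP; exists x.
Qed.

Lemma crit_diffE {U : finType} {H : sgraph U} {X : {set U}} :
  X \subset vset H ->
  (forall A : {set U}, A \subset vset H -> (diff H A <= diff H X)%R) ->
  crit_diff H = diff H X.
Proof.
move=> XH maxX; apply/le_anti/andP; split.
  (* [bigmax_le] also asks for a bound on the default value [diff H set0], which is the case of the
     empty set. *)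
  by apply: bigmax_le => [|A]; apply: maxX; rewrite ?sub0set.
exact: le_bigmax_cond.
Qed.

Lemma hall_of_max_diff {U : finType} {G : sgraph U} {X B : {set U}} :
  (forall Y : {set U}, Y \subset X -> (diff G Y <= diff G X)%R) ->
  B \subset nbhd G X -> #|B| <= #|nbhd G B :&: X|.
Proof.
move=> maxX BN.
have := maxX _ (subsetDl X (nbhd G B)); rewrite /diff.
(* A neighbour of [B] lies in [nbhd G B], so deleting these vertices from [X] removes all of [B]
   from the neighbourhood. *)
have /subset_leq_card : nbhd G (X :\: nbhd G B) \subset nbhd G X :\: B.
  rewrite subsetD nbhdS ?subsetDl //=; apply/pred0P => y /=; apply/negP.
  case/andP=> /nbhdP[x /setDP[_ /nbhdP xNB] xy] yB; apply: xNB.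
  by exists y => //; rewrite adj_sym.
have := cardsID B (nbhd G X); rewrite (setIidPr BN).
have := cardsID (nbhd G B) X; rewrite [X :&: _]setIC.
lia.
Qed.

Section HX.
Context {U : finType} {G : sgraph U} {X : {set U}} {v w : U}.
Hypotheses (X_indep : independent G X).
Hypotheses (vG : v \notin vset G) (wG : w \notin vset G) (vw : v != w).
Let H := HX X vG vw.

(** By independence [X] misses [nbhd G X], and it avoids [v] and [w], so an edge of [H] at a vertex
    of [X] can only come from the first clause of [HX_arc]. *)
Lemma nbhd_HX_id : nbhd H X = nbhd G X.
Proof.
have [/subsetP XG XX] := X_indep.
apply/setP => y; apply/nbhdP/nbhdP => -[x xX]; last first.
  move=> xy; exists x => //; apply/orP; left; apply/or3P/Or31.
  by rewrite xX xy andbT; apply/nbhdP; exists x.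
have xv : x != v by apply: contraNneq vG => <-; apply: XG.
have xw : x != w by apply: contraNneq wG => <-; apply: XG.
have xN : x \notin nbhd G X.
  by apply/nbhdP => -[z zX]; apply/negP/XX.
rewrite /= /HX_adj /HX_arc (negPf xv) (negPf xw) (negPf xN) !andbF !orbF.
by case/and3P; exists x.
Qed.

Lemma sub_nbhd_HX (A : {set U}) :
  [/\ nbhd G (A :&: X) \subset nbhd H A,
      nbhd G (A :&: nbhd G X) :&: X \subset nbhd H A
    & [set tperm v w x | x in A :&: [set v; w]] \subset nbhd H A].
Proof.
split; apply/subsetP => y.
- case/nbhdP=> x /setIP[xA xX] xy; apply/nbhdP; exists x => //.
  apply/orP; left; apply/or3P/Or31.
  by rewrite xX xy andbT; apply/nbhdP; exists x.
- case/setIP=> /nbhdP[x /setIP[xA xN] xy] yX; apply/nbhdP; exists x => //.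
  by apply/orP; right; apply/or3P/Or31; rewrite yX xN adj_sym.
- case/imsetP=> x /setIP[xA /set2P xvw] ->; apply/nbhdP; exists x => //.
  rewrite /= /HX_adj /HX_arc.
  by case: xvw => ->; rewrite ?tpermL ?tpermR !eqxx ?orbT.
Qed.

Lemma diff_HX_le (A : {set U}) :
  (forall Y : {set U}, Y \subset X -> (diff G Y <= diff G X)%R) ->
  A \subset vset H -> (diff H A <= diff G (A :&: X))%R.
Proof.
move=> maxX AH; have [/subsetP XG XX] := X_indep.
have [sY sB sT] := sub_nbhd_HX A.
have hall := hall_of_max_diff maxX (subsetIr A (nbhd G X)).
set P := nbhd G (A :&: X) in sY *.
set Q := _ :&: X in sB hall.
set T := imset _ _ in sT.
have cardT : #|T| = #|A :&: [set v; w]| by rewrite card_imset //; apply: perm_inj.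
have PQ : [disjoint P & Q].
  apply/pred0P => y /=; apply/negP => /andP[/nbhdP[x /setIP[_ xX] xy] /setIP[_ yX]].
  by case/negP: (XX _ _ xX yX).
have PQT : [disjoint P :|: Q & T].
  apply/pred0P => y /=; apply/negP => /andP[yPQ /imsetP[x /setIP[_ xvw] yx]].
  have : y \in vset G.
    by case/setUP: yPQ => [/nbhd_vset | /setIP[_ /XG]].
  by apply/negP; rewrite yx; case/set2P: xvw => ->; rewrite ?tpermL ?tpermR.
have cardN : #|P| + #|Q| + #|T| <= #|nbhd H A|.
  (* Disjointness is the equality case of [leq_card_setU], so the three cardinals add up to that of
     the union. *)
  move: PQ PQT; rewrite -!leq_card_setU => /eqP <- /eqP <-.
  by apply: subset_leq_card; rewrite !subUset sY sB sT.
have cardA : #|A| <= #|A :&: X| + #|A :&: nbhd G X| + #|A :&: [set v; w]|.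
  rewrite -{1}(setIidPl AH) /= /HX_vset !setIUr.
  by apply: leq_trans (leq_card_setU _ _) _; rewrite leq_add2r leq_card_setU.
(* In [cardA] minus [cardN], the new vertices cancel by [cardT], and [hall] bounds the part of [A]
   in [nbhd G X] by [#|Q|]. *)
rewrite /diff -/P; lia.
Qed.

End HX.

Theorem theorem2p7 (U : finType) (G : sgraph U) (X : {set U})
    (X_indep : independent G X)
    (X_pos : (0 < diff G X)%R)
    (X_min : forall Y : {set U}, Y \proper X -> (diff G Y < diff G X)%R)
    (v w : U)
    (vG : v \notin vset G) (wG : w \notin vset G) (vw : v != w) :
  ker (HX X vG vw) = X.
Proof.
have maxX (Y : {set U}) : Y \subset X -> (diff G Y <= diff G X)%R.
  by rewrite subEproper => /predU1P[-> // | /X_min /ltW].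
set H := HX X vG vw.
have XH : X \subset vset H by rewrite /= /HX_vset -setUA subsetUl.
have dX : diff H X = diff G X by rewrite /diff nbhd_HX_id.
have leY (A : {set U}) : A \subset vset H -> (diff H A <= diff G (A :&: X))%R.
  exact: diff_HX_le.
have critE : crit_diff H = diff G X.
  rewrite (crit_diffE XH) // => A AH; rewrite dX.
  by apply: le_trans (leY A AH) (maxX _ (subsetIr _ _)).
apply/eqP; rewrite eqEsubset; apply/andP; split.
  by apply: bigcap_inf; rewrite /critical XH critE dX eqxx.
apply/bigcapsP => A /andP[AH /eqP dA].
(* If [A :&: X] were proper in [X], its difference would be below [diff G X], which equals
   [diff H A], against [leY]. *)
have := subsetIr A X; rewrite subEproper => /predU1P[/setIidPr // | /X_min].
by rewrite ltNge -critE -dA leY.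
Qed.
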